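(* Let $\langle P_1,\ldots,P_m\rangle$ be a decompilation pipeline with initial $\mathbb{N}[X]$-annotated relation store $D_0$, and let $D_m$ be its final store. If a fact $(r,t)$ (a relation symbol $r:\tau$ of the global schema $\mathcal{R}$ together with a tuple $t\in\operatorname{Tuples}(\tau)$) admits a coverage witness with leaves in $D_0$, then $$D_m(r)(t)\neq 0 .$$ In particular, if for an IR level $\ell$, a node $n\in N$ and a statement $s\in S_\ell$ the statement candidate $(n,s)$ at level $\ell$ admits a coverage witness, then $(s,\kappa)\in \mathit{Cand}_\ell(n)$ for some $\kappa\neq 0$, where $\mathit{Cand}_\ell(n)$ is computed in the store $D_m$.
   Context: **Annotations.** $X=\{x_1,x_2,\ldots\}$ is a countable set of provenance tokens and $\mathbb{N}[X]$ is the commutative semiring of multivariate polynomials with coefficients in $\mathbb{N}$ and indeterminates from $X$, with $\oplus=+$, $\otimes=\times$, $\bar 0=0$, $\bar 1=1$. It is ordered by its natural order: $a\le b$ iff $a\oplus c=b$ for some $c$. **Schema and stores.** $\mathcal{L}$ is a finite partially ordered set of IR (intermediate representation) levels. A finite set of constants (the active domain) and a finite global schema $\mathcal{R}$ of typed relation symbols $r:\tau$ are fixed; $\operatorname{Tuples}(\tau)$ is the (finite) set of tuples of type $\tau$ over the active domain. $\mathcal{R}$ is the union of finite schemas $\mathcal{R}_\ell$, $\ell\in\mathcal{L}$, together with auxiliary relations. An annotated relation store $D$ (with annotations in $\mathbb{N}[X]$) assigns to each $r:\tau$ in $\mathcal{R}$ a function $D(r):\operatorname{Tuples}(\tau)\to\mathbb{N}[X]$.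 Stores are ordered pointwise by the natural order. **Statement candidates.** $N$ is the set of nodes (program points). For each level $\ell$, $S_\ell$ is the set of statements at level $\ell$, and $r_\ell\in\mathcal{R}_\ell$ is the principal statement relation, whose tuples are pairs $(n,s)$ with $n\in N$, $s\in S_\ell$. For a store $D$, $\mathit{Cand}_\ell(n)=\{(s,\kappa)\mid s\in S_\ell,\ \kappa=D(r_\ell)(n,s)\neq 0\}$. **Passes.** A pass is a triple $P=(\mathcal{I},\mathcal{O},\Delta)$ with $\mathcal{I},\mathcal{O}\subseteq\mathcal{R}$ and $\Delta$ a finite set of positive (negation-free) Datalog rules whose body atoms use relations in $\mathcal{I}$ and whose heads use relations in $\mathcal{O}$ ($\mathcal{I}$ and $\mathcal{O}$ may overlap). Its immediate consequence operator $T_P$ maps a store $D$ to the store $T_P(D)$ that agrees with $D$ on relations outside $\mathcal{O}$ and, for $r\in\mathcal{O}$ and a tuple $t$, satisfies $$T_P(D)(r)(t)=\bigoplus_{\substack{\rho\in\Delta\\ \mathrm{head}(\rho)=r(\vec u)}}\ \bigoplus_{\theta:\ \theta(\vec u)=t}\ \bigotimes_{a\in\mathrm{body}(\rho)} D(\mathrm{rel}(a))\bigl(\theta(\mathrm{args}(a))\bigr),$$ where $\theta$ ranges over assignments of the variables of $\rho$ to active-domain constants, and $\mathrm{rel}(a)$, $\mathrm{args}(a)$ are the relation symbol and argument tuple of the atom $a$. **Pipelines.** A decompilation pipeline is a sequence of passes $P_1,\ldots,P_m$, $P_j=(\mathcal{I}_j,\mathcal{O}_j,\Delta_j)$, with an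 initial annotated store $D_0$. The store evolves as $D_0\to D_1\to\cdots\to D_m$, where $D_j$ is the least fixed point reached by iterating the immediate consequence operator of $P_j$ starting from $D_{j-1}$, with facts only ever being added. Precisely: put $E_0=D_{j-1}$; let $E_{i+1}$ agree with $D_{j-1}$ on relations outside $\mathcal{O}_j$ and set $E_{i+1}(r)(t)=D_{j-1}(r)(t)\oplus T_{P_j}(E_i)(r)(t)$ for $r\in\mathcal{O}_j$. It is a standing assumption that this iteration stabilizes after finitely many steps for each $j$; $D_j$ is the stable value. **Derivations and witnesses.** A fact $(r,t)$ is an extensional input fact of $D_0$ if $D_0(r)(t)\neq 0$. An implemented derivation step is an instance (under some $\theta$) of a rule in some pass $P_j$ whose body facts are present in the store when $P_j$ is evaluated and whose head is the fact it adds. A derivation (equivalently, a coverage witness) for $(r,t)$ is a finite tree of such steps rooted at $(r,t)$ whose leaves are extensional input facts of $D_0$: each internal node is a fact that is the head of a rule instance of some pass $P_j$, its children are exactly the body facts of that instance, and each child is either a leaf (an extensional input fact of $D_0$) or is itself derived in the tree by a step of a pass $P_{j'}$ with $j'\le j$ (a rule instance with empty body may also justify a node with no children). A coverage witness for a statement candidate $(n,s)$ at level $\ell$ is a coverage witness for the fact $(r_\ell,(n,s))$. *)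

(* Defs.v *)
From HB Require Import structures.
From mathcomp Require Import all_boot all_order all_algebra.
From mathcomp Require Import finmap.
From mathcomp Require Import monalg.

Set Implicit Arguments.
Unset Strict Implicit.
Unset Printing Implicit Defensive.

Import Order.TTheory GRing.Theory Num.Theory.
Local Open Scope ring_scope.

(* [{malg G[K]}] requires [G] to have opposites, so N[X] is realised as the
   subsemiring of Z[X] of the polynomials whose coefficients are all >= 0. *)
Definition provpoly_pred (X : countType) : {pred {malg int[{cmonom X}]}} :=
  fun p => p \is a monalgOver Num.nneg.
Arguments provpoly_pred X _ : clear implicits.

Lemma provpoly_semiring_closed (X : countType) :
  semiring_closed (provpoly_pred X).
Proof.
pose S := GRing.SemiringClosed.clone int (@Num.Def.nneg_num_pred int) _.
have [h1 h2] := monalgOver_addr_closed {cmonom X} S.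
have [h3 h4] := monalgOver_mulr_closed {cmonom X} S.
by split.
Qed.

HB.instance Definition _ (X : countType) :=
  GRing.isSemiringClosed.Build _ (provpoly_pred X)
    (provpoly_semiring_closed X).

Record provpoly (X : countType) := ProvPoly {
  provpoly_val : {malg int[{cmonom X}]};
  provpoly_valP : provpoly_val \in provpoly_pred X
}.

HB.instance Definition _ (X : countType) := [isSub for @provpoly_val X].
HB.instance Definition _ (X : countType) := [Choice of provpoly X by <:].
HB.instance Definition _ (X : countType) :=
  [SubChoice_isSubComNzSemiRing of provpoly X by <:].

(* A relation type is the list of the atomic types of its columns; an atomic
   type is interpreted by a set of constants of the active domain. *)
Record schema := Schema {
  const : finType;
  atype : Type;
  dom : atype -> {set const};
  relsym : finType;
  rtype : relsym -> seq atype;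
  level_disp : Order.disp_t;
  level : finPOrderType level_disp;
  level_rels : level -> {set relsym};
  aux_rels : {set relsym};
  node_type : atype;
  stmt_type : level -> atype;
  princ : level -> relsym;
  relsE : (\bigcup_(l : level) level_rels l) :|: aux_rels = [set: relsym];
  princ_in : forall l, princ l \in level_rels l;
  princ_type : forall l, rtype (princ l) = [:: node_type; stmt_type l]
}.

Definition has_type (S : schema) (tau : seq (atype S)) (cs : seq (const S)) :=
  all2 (fun c sigma => c \in dom sigma) cs tau.

Definition tuples (S : schema) (tau : seq (atype S)) :=
  {cs : seq (const S) | has_type tau cs}.

Definition store (S : schema) (X : countType) :=
  forall r : relsym S, tuples (rtype r) -> provpoly X.

(* Facts only exist for well-typed tuples: an ill-typed one has value 0. *)
Definition lookup (S : schema) (X : countType) (D : store S X)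
    (r : relsym S) (cs : seq (const S)) : provpoly X :=
  if insub cs is Some t then D r t else 0.

Definition node (S : schema) := {c : const S | c \in dom (node_type S)}.

Definition stmt (S : schema) (l : level S) :=
  {c : const S | c \in dom (stmt_type l)}.

Lemma princ_has_type (S : schema) (l : level S) (n : node S) (s : stmt l) :
  has_type (rtype (princ l)) [:: val n; val s].
Proof. by rewrite princ_type /has_type /= (valP n) (valP s). Qed.

Definition princ_tuple (S : schema) (l : level S) (n : node S) (s : stmt l) :
    tuples (rtype (princ l)) :=
  Sub [:: val n; val s] (princ_has_type n s).

Definition Cand (S : schema) (X : countType) (D : store S X) (l : level S)
    (n : node S) : stmt l * provpoly X -> Prop :=
  fun sk => sk.2 = D (princ l) (princ_tuple n sk.1) /\ sk.2 != 0.

(* Variables are named by natural numbers; [V] is the set of variables of a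
   rule, and a term is a variable in [V] or a constant. *)
Definition term (S : schema) (V : {fset nat}) := (V + const S)%type.

Definition atom (S : schema) (V : {fset nat}) :=
  {r : relsym S & (size (rtype r)).-tuple (term S V)}.

Definition rule (S : schema) :=
  {V : {fset nat} & (atom S V * seq (atom S V))%type}.

Definition rvars (S : schema) (rho : rule S) : {fset nat} := tag rho.

Definition head (S : schema) (rho : rule S) : atom S (rvars rho) :=
  (tagged rho).1.

Definition body (S : schema) (rho : rule S) : seq (atom S (rvars rho)) :=
  (tagged rho).2.

Definition all_vars_occur (S : schema) (rho : rule S) :=
  forall x : rvars rho,
    has (fun a : atom S (rvars rho) => inl x \in tagged a)
        (head rho :: body rho).

Definition assignment (S : schema) (V : {fset nat}) := {ffun V -> const S}.

Definition subst (S : schema) (V : {fset nat}) (theta : assignment S V)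
    (u : term S V) : const S :=
  match u with inl x => theta x | inr c => c end.

Definition ground (S : schema) (V : {fset nat}) (theta : assignment S V)
    (a : atom S V) : seq (const S) :=
  [seq subst theta u | u <- tagged a].

Record pass (S : schema) := Pass {
  inputs : {set relsym S};
  outputs : {set relsym S};
  rules : {fset rule S};
  rules_vars : forall rho, rho \in rules -> all_vars_occur rho;
  rules_body : forall rho, rho \in rules ->
    forall a, a \in body rho -> tag a \in inputs;
  rules_head : forall rho, rho \in rules -> tag (head rho) \in outputs
}.

Definition immediate (S : schema) (X : countType) (P : pass S)
    (D : store S X) : store S X :=
  fun r t =>
    if r \in outputs P then
      \sum_(rho <- rules P | tag (head rho) == r)
        \sum_(theta : assignment S (rvars rho)
                | ground theta (head rho) == val t)
          \prod_(a <- body rho) lookup D (tag a) (ground theta a)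
    else D r t.

Fixpoint iterate (S : schema) (X : countType) (P : pass S) (D : store S X)
    (i : nat) : store S X :=
  if i is i'.+1 then
    fun r t =>
      if r \in outputs P then D r t + immediate P (iterate P D i') t
      else D r t
  else D.

Definition stabilizes_to (S : schema) (X : countType) (P : pass S)
    (D D' : store S X) :=
  exists k, forall i, (k <= i)%N ->
    forall r (t : tuples (rtype r)), iterate P D i t = D' r t.

(* [D j] is the store after the first [j] passes; pass [j : 'I_m] is the
   (j+1)-st one.  Only [D 0], ..., [D m] are constrained. *)
Definition pipeline_run (S : schema) (X : countType) (m : nat)
    (P : m.-tuple (pass S)) (D : nat -> store S X) :=
  forall j : 'I_m, stabilizes_to (tnth P j) (D j) (D j.+1).

(* [derivation P D0 k t] : finite trees rooted at the fact (r, t) that are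
   either a leaf or end with a step of a pass of index <= k.  The presence of
   the body facts in the store when the pass is evaluated is not assumed: it
   is a consequence of the ordering constraint on the passes. *)
Inductive derivation (S : schema) (X : countType) (m : nat)
    (P : m.-tuple (pass S)) (D0 : store S X) (k : nat) :
    forall r : relsym S, tuples (rtype r) -> Prop :=
| deriv_leaf (r : relsym S) (t : tuples (rtype r)) :
    D0 r t != 0 -> derivation P D0 k t
| deriv_step (j : 'I_m) (rho : rule S) (theta : assignment S (rvars rho))
    (t : tuples (rtype (tag (head rho)))) :
    (j <= k)%N ->
    rho \in rules (tnth P j) ->
    val t = ground theta (head rho) ->
    (forall a, a \in body rho ->
       exists2 t' : tuples (rtype (tag a)),
         val t' = ground theta a & derivation P D0 j t') ->
    derivation P D0 k t.

(* The bound [m] leaves the pass used at the root unconstrained. *)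
Definition coverage_witness (S : schema) (X : countType) (m : nat)
    (P : m.-tuple (pass S)) (D0 : store S X) (r : relsym S)
    (t : tuples (rtype r)) : Prop :=
  derivation P D0 m t.

(* Main.v *)
(* N[X] is a positive semiring: sums vanish only if all terms do, and products
   of nonzero elements are nonzero.  Hence presence of a fact is preserved from
   each store of the pipeline to the next, and a rule instance whose body facts
   are present in the stable store of a pass has its head present there too.
   Induction on the witness shows that a fact whose root step belongs to the
   j-th pass is present after that pass. *)
Require Import Defs.
From HB Require Import structures.
From mathcomp Require Import all_boot all_order all_algebra.
From mathcomp Require Import finmap.
From mathcomp Require Import monalg.

Set Implicit Arguments.
Unset Strict Implicit.
Unset Printing Implicit Defensive.

Import Order.TTheory GRing.Theory Num.Theory.
Local Open Scope ring_scope.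

Lemma provpoly_ge0 (X : countType) (p : provpoly X) (k : {cmonom X}) :
  0 <= (val p)@_k.
Proof. by case: p => p /= /monalgOverP /(_ k). Qed.

(** A positive coefficient, unlike a merely nonzero one, cannot be cancelled by adding coefficients
    [>= 0]. *)
Lemma provpoly_neq0P (X : countType) (p : provpoly X) :
  reflect (exists k, 0 < (val p)@_k) (p != 0).
Proof.
have val0 : val (0 : provpoly X) = 0 by exact: raddf0.
apply: (iffP idP) => [p_neq0 | [k pk_gt0]].
  have : msupp (val p) != fset0 by rewrite msupp_eq0 -val0 val_eqE.
  case/fset0Pn => k; rewrite -mcoeff_neq0 => pk; exists k.
  by rewrite lt0r pk provpoly_ge0.
by apply: contraTneq pk_gt0 => ->; rewrite val0 mcoeff0 ltxx.
Qed.

Lemma provpoly_addl_neq0 (X : countType) (p q : provpoly X) :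
  p != 0 -> p + q != 0.
Proof.
move/provpoly_neq0P => [k pk_gt0]; apply/provpoly_neq0P; exists k.
by rewrite (raddfD val) mcoeffD ltr_wpDr ?provpoly_ge0.
Qed.

(** The coefficient of [p * q] at [mmul k l] is a double sum of terms [>= 0] that contains the
    positive product of the coefficients at [k] and [l]. *)
Lemma provpoly_mul_neq0 (X : countType) (p q : provpoly X) :
  p != 0 -> q != 0 -> p * q != 0.
Proof.
move/provpoly_neq0P => [k pk_gt0] /provpoly_neq0P [l ql_gt0].
have term_ge0 i j n : 0 <= (val p)@_i * (val q)@_j *+ n.
  by rewrite mulrn_wge0 ?mulr_ge0 ?provpoly_ge0.
apply/provpoly_neq0P; exists (mmul k l); rewrite (rmorphM val) mcoeffMl.
have supp (g : {malg int[{cmonom X}]}) i : 0 < g@_i -> i \in msupp g.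
  by rewrite -mcoeff_neq0 => /gt_eqF ->.
rewrite (bigD1_seq k) ?fset_uniq ?supp //= ltr_wpDr //.
  by apply: sumr_ge0 => i _; apply: sumr_ge0.
rewrite (bigD1_seq l) ?fset_uniq ?supp //= ltr_wpDr //; first exact: sumr_ge0.
by rewrite eqxx mulr1n mulr_gt0.
Qed.

Lemma provpoly_sum_neq0 (X : countType) (I : eqType) (s : seq I) (Q : pred I)
    (F : I -> provpoly X) (i : I) :
  i \in s -> Q i -> F i != 0 -> \sum_(j <- s | Q j) F j != 0.
Proof.
move=> s_i Qi Fi; rewrite (perm_big _ (perm_to_rem s_i)) big_cons Qi.
exact: provpoly_addl_neq0.
Qed.

Lemma provpoly_prod_neq0 (X : countType) (I : eqType) (s : seq I)
    (F : I -> provpoly X) :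
  (forall i, i \in s -> F i != 0) -> \prod_(i <- s) F i != 0.
Proof.
move=> F_neq0; rewrite big_seq; elim/big_rec: _ => [|i p s_i p_neq0].
  exact: oner_neq0.
exact: provpoly_mul_neq0 (F_neq0 i s_i) p_neq0.
Qed.

(** Stores are functions and stabilization is only pointwise, so a stable iterate [E] stands in for
    [D'] under [immediate]; this avoids functional extensionality. *)
Lemma stabilizes_to_fixpoint (S : schema) (X : countType) (P : pass S)
    (D D' : store S X) :
  stabilizes_to P D D' ->
  exists2 E : store S X, (forall r (t : tuples (rtype r)), E r t = D' r t) &
    forall r (t : tuples (rtype r)),
      D' r t = if r \in outputs P then D r t + immediate P E t else D r t.
Proof.
case=> k Dk; exists (iterate P D k) => r t; first exact: Dk.
by rewrite -(Dk k.+1).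
Qed.

Lemma stabilizes_to_neq0 (S : schema) (X : countType) (P : pass S)
    (D D' : store S X) (r : relsym S) (t : tuples (rtype r)) :
  stabilizes_to P D D' -> D r t != 0 -> D' r t != 0.
Proof.
case/stabilizes_to_fixpoint => E _ -> Drt; case: ifP => // _.
exact: provpoly_addl_neq0.
Qed.

Lemma lookup_val (S : schema) (X : countType) (D : store S X) (r : relsym S)
    (t : tuples (rtype r)) : lookup D r (val t) = D r t.
Proof. by rewrite /lookup valK. Qed.

Lemma stabilizes_to_step_neq0 (S : schema) (X : countType) (P : pass S)
    (D D' : store S X) (rho : rule S) (theta : assignment S (rvars rho))
    (t : tuples (rtype (tag (Defs.head rho)))) :
  stabilizes_to P D D' -> rho \in rules P ->
  val t = ground theta (Defs.head rho) ->
  (forall a, a \in body rho ->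
     exists2 t' : tuples (rtype (tag a)),
       val t' = ground theta a & D' (tag a) t' != 0) ->
  D' (tag (Defs.head rho)) t != 0.
Proof.
case/stabilizes_to_fixpoint => E ED' -> P_rho t_head body_D'.
rewrite (rules_head P_rho) addrC; apply: provpoly_addl_neq0.
rewrite /immediate (rules_head P_rho).
(* By positivity it suffices that the single summand given by [rho] and [theta] is nonzero. *)
apply: (provpoly_sum_neq0 P_rho) => //.
apply: (@provpoly_sum_neq0 _ _ _ _ _ theta); rewrite ?mem_index_enum //.
  by rewrite t_head.
apply: provpoly_prod_neq0 => a /body_D' [t' <-].
by rewrite lookup_val ED'.
Qed.

Lemma pipeline_run_neq0 (S : schema) (X : countType) (m : nat)
    (P : m.-tuple (pass S)) (D : nat -> store S X) (i j : nat)
    (r : relsym S) (t : tuples (rtype r)) :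
  pipeline_run P D -> (i <= j <= m)%N -> D i r t != 0 -> D j r t != 0.
Proof.
move=> D_run /andP[]; elim: j => [|j IHj]; first by rewrite leqn0 => /eqP ->.
rewrite leq_eqVlt => /predU1P[-> //|ij] jm Di.
exact: stabilizes_to_neq0 (D_run (Ordinal jm)) (IHj ij (ltnW jm) Di).
Qed.

(* Passes are numbered from 0, so a fact derived with passes of index at most
   [k] is present in the store [D k.+1]. *)
Lemma derivation_neq0 (S : schema) (X : countType) (m : nat)
    (P : m.-tuple (pass S)) (D : nat -> store S X) :
  pipeline_run P D ->
  forall (k : nat) (r : relsym S) (t : tuples (rtype r)),
    derivation P (D 0) k t -> D (minn k.+1 m) r t != 0.
Proof.
(* Recursion on the derivation itself: its subtrees are nested under [exists2], where the generated
   induction principle gives no hypothesis. *)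
move=> D_run; fix IH 4.
move=> k r t [{}r {}t D0rt | j rho theta {}t jk Pj_rho t_head dbody].
  by apply: pipeline_run_neq0 D_run _ D0rt; rewrite geq_minr.
(* As [j < m], the recursive call places the children in [D j.+1], the stable store of pass [j]
   itself. *)
have j1m : minn j.+1 m = j.+1 by apply/minn_idPl.
apply: (pipeline_run_neq0 (i := j.+1) D_run).
  by rewrite leq_min ltnS jk ltn_ord geq_minr.
apply: (stabilizes_to_step_neq0 (D_run j) Pj_rho t_head) => a rho_a.
(* A direct [case]: the guard condition would reject [have := dbody a rho_a]. *)
case: (dbody a rho_a) => t' t'_a d; exists t' => //.
by rewrite -j1m; apply: IH d.
Qed.

Theorem theorem3p12 (S : schema) (X : countType) (m : nat)
    (P : m.-tuple (pass S)) (D0 : store S X) (D : nat -> store S X)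
    (D_init : D 0%N = D0) (D_run : pipeline_run P D) :
  (forall (r : relsym S) (t : tuples (rtype r)),
     coverage_witness P D0 t -> D m r t != 0) /\
  (forall (l : level S) (n : node S) (s : stmt l),
     coverage_witness P D0 (princ_tuple n s) ->
     exists kappa : provpoly X, kappa != 0 /\ Cand (D m) n (s, kappa)).
Proof.
have Dm_neq0 r (t : tuples (rtype r)) : coverage_witness P D0 t -> D m r t != 0.
  rewrite /coverage_witness -D_init => /(derivation_neq0 D_run).
  (* The root bound [m] exceeds every pass index; the [minn] caps the resulting store at [D m]. *)
  by rewrite (minn_idPr (leqnSn m)).
split=> // l n s /Dm_neq0 Dm_s.
by exists (D m (princ l) (princ_tuple n s)).
Qed.
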